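(* Let $n$ be a positive integer and let $Q_{4n}$ be the dicyclic group of order $4n$, with cyclic subgroup $\langle a\rangle$ of order $2n$ and an element $b\notin\langle a\rangle$ satisfying $b^{2}=a^{n}$ and $bab^{-1}=a^{-1}$. Then $\omega(Q_{4n})=\{d\in\mathbb{N}: d\mid 2n\}\cup\{4\}$, so $\eta(Q_{4n})=\tau(2n)$ when $n$ is even and $\eta(Q_{4n})=\tau(2n)+1$ when $n$ is odd.
   Context: For a finite group $G$, $\omega(G)$ denotes the set of orders of elements of $G$ and $\eta(G)=|\omega(G)|$. $\tau(m)$ is the number of positive divisors of $m$. *)

(* Defs.v *)
From mathcomp Require Import all_boot all_fingroup.
From mathcomp Require Import finmap.

Set Implicit Arguments.
Unset Strict Implicit.
Unset Printing Implicit Defensive.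

Local Open Scope group_scope.

Definition omega (gT : finGroupType) (G : {group gT}) : {fset nat} :=
  [fset #[x] | x in G]%fset.

Definition eta (gT : finGroupType) (G : {group gT}) : nat := #|` omega G|%fset.

Definition tau (m : nat) : nat := size (divisors m).

(* The dicyclic group is determined only up to isomorphism, so it is given by
   a predicate on groups. For n = 1 this is the cyclic group of order 4. *)
Definition dicyclic (n : nat) (gT : finGroupType) (G : {group gT}) : Prop :=
  #|G| = (4 * n)%N /\
  exists a b : gT,
    [/\ a \in G, b \in G & #|<[a]>| = (2 * n)%N] /\
    [/\ b \notin <[a]>, b ^+ 2 = a ^+ n & b * a * b^-1 = a^-1].

(* Main.v *)
Require Import Defs.
From mathcomp Require Import all_boot all_fingroup.
From mathcomp Require Import cyclic.
From mathcomp Require Import finmap.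

(** The subgroup [A = <[a]>] has index 2, so [G] is the disjoint union of [A] and
    the coset [A :* b].  The cyclic group [A] of order [2 * n] contributes exactly
    the divisors of [2 * n] to the set of orders.  Outside [A] every element has
    order 4: since [b] inverts [A], the square of [u * b] with [u] in [A] is
    [u * (b * u * b^-1) * b ^+ 2 = u * u^-1 * b ^+ 2 = a ^+ n], which has order 2.
    The two counts then differ only in whether 4 already divides [2 * n], that is,
    whether [n] is even. *)

Local Open Scope group_scope.

(** Comparing cardinalities avoids the quotient group: the coset of [b] misses
    [A] and has half the elements of [G]. *)
Lemma setD_index2 (gT : finGroupType) (G A : {group gT}) (b : gT) :
  A \subset G -> #|G| = (2 * #|A|)%N -> b \in G -> b \notin A ->
  G :\: A = A :* b.
Proof.
move=> sAG cardG Gb nAb; apply/esym/eqP; rewrite eqEcard card_rcoset.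
rewrite cardsD (setIidPr sAG) cardG mul2n -addnn addnK leqnn andbT.
apply/subsetP=> _ /rcosetP[u Au ->]; rewrite inE groupMl // nAb.
by rewrite groupM // (subsetP sAG).
Qed.

Lemma sqr_mul_inverting (gT : finGroupType) (u b : gT) :
  b * u * b^-1 = u^-1 -> (u * b) ^+ 2 = b ^+ 2.
Proof.
move=> ub; have bu: b * u = u^-1 * b by rewrite -ub mulgKV.
by rewrite !expgS !expg0 !mulg1 -mulgA (mulgA b) bu !mulgA mulgV mul1g.
Qed.

(** Conjugation is a morphism, so inverting the generator inverts its powers. *)
Lemma inverting_cycle (gT : finGroupType) (a b u : gT) :
  b * a * b^-1 = a^-1 -> u \in <[a]> -> b * u * b^-1 = u^-1.
Proof.
have conjE x: b * x * b^-1 = x ^ b^-1 by rewrite conjgE invgK mulgA.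
by rewrite !conjE => ab /cycleP[k ->]; rewrite conjXg ab expgVn.
Qed.

Lemma order_dicyclic_outside (gT : finGroupType) (a b x : gT) (n : nat) :
  0 < n -> #[a] = (2 * n)%N -> b ^+ 2 = a ^+ n -> b * a * b^-1 = a^-1 ->
  x \in <[a]> :* b -> #[x] = 4.
Proof.
move=> n_gt0 oa b2 ab /rcosetP[u au ->].
(* A square of even order comes from an element of twice that order. *)
apply: (orderXprime (n := 2) (p := 2)) => //.
rewrite (sqr_mul_inverting _ _ _ (inverting_cycle _ _ _ _ ab au)) b2.
by rewrite orderXdiv oa ?dvdn_mull // mulnK.
Qed.

(** A divisor [d] of [#[a]] is the order of [a ^+ (#[a] %/ d)]. *)
Lemma cycle_orderP (gT : finGroupType) (a : gT) (d : nat) :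
  reflect (exists2 x, x \in <[a]> & #[x] = d) (d %| #[a]).
Proof.
apply: (iffP idP) => [d_a | [x ax <-]]; last exact: order_dvdG.
exists (a ^+ (#[a] %/ d)); first exact: mem_cycle.
by rewrite orderXdiv ?dvdn_div // divnA // mulKn.
Qed.

Lemma omega_dicyclic (n : nat) (gT : finGroupType) (G : {group gT}) :
  0 < n -> dicyclic n G ->
  omega G = ([fset d in divisors (2 * n)] `|` [fset 4])%fset.
Proof.
move=> n_gt0 [cardG [a [b [[Ga Gb oa] [nab b2 ab]]]]].
have sAG: <[a]> \subset G by rewrite cycle_subG.
have cosetE: G :\: <[a]> = <[a]> :* b.
  by apply: setD_index2 => //; rewrite oa cardG mulnA.
have o4 x := order_dicyclic_outside _ a b x n n_gt0 oa b2 ab.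
have div_a d: (d \in divisors (2 * n)) = (d %| #[a]).
  by rewrite -dvdn_divisors ?muln_gt0 // -oa.
apply/fsetP=> d; rewrite !inE div_a; apply/imfsetP/idP => /= [[x Gx ->] |].
  have [ax | nax] := boolP (x \in <[a]>); first by rewrite order_dvdG.
  by rewrite (o4 x) ?eqxx ?orbT // -cosetE inE nax.
case/orP=> [/cycle_orderP[x ax <-] | /eqP->].
  by exists x => //; apply: (subsetP sAG).
by exists b => //; rewrite (o4 b) ?rcoset_refl.
Qed.

Lemma card_fset_divisors (m : nat) : #|` [fset d in divisors m]|%fset = tau m.
Proof. by rewrite card_fseq undup_id ?divisors_uniq. Qed.

Local Close Scope group_scope.

Theorem proposition7p2 (n : nat) (n_gt0 : 0 < n)
    (gT : finGroupType) (G : {group gT}) (dicG : dicyclic n G) :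
  omega G = ([fset d in divisors (2 * n)] `|` [fset 4])%fset /\
  (~~ odd n -> eta G = tau (2 * n)) /\
  (odd n -> eta G = tau (2 * n) + 1).
Proof.
have omegaE := omega_dicyclic n gT G n_gt0 dicG.
(* Dividing by 2, 4 divides 2 * n exactly when 2 divides n. *)
have mem4: (4 \in [fset d in divisors (2 * n)]%fset) = ~~ odd n.
  by rewrite inE /= -dvdn_divisors ?muln_gt0 // (@dvdn_pmul2l 2 2) // dvdn2.
have etaE: eta G = (odd n + tau (2 * n))%N.
  by rewrite /eta omegaE fsetUC cardfsU1 mem4 negbK card_fset_divisors.
split=> //; split=> [/negbTE n_even | n_odd].
  by rewrite etaE n_even.
by rewrite etaE n_odd addnC.
Qed.
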